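(* Let $T$ be a tree of order $n \geq 4$ with maximum degree $\Delta(T) \geq 3$. Then $$\mathrm{hc}(T) \geq (n-1)(n-1-\zeta(T)) + \zeta'(T) - 2\mathcal{L}_W(T).$$
   Context: For a connected graph $G$ of order $n$, the detour distance $D(u,v)$ is the length of a longest $u$–$v$ path (in a tree it equals the ordinary distance $d(u,v)$). A hamiltonian coloring of $G$ is a map $h: V(G) \to \{0,1,2,\ldots\}$ such that $D(u,v) + |h(u)-h(v)| \geq n-1$ for all distinct $u,v \in V(G)$. Its span is $\max\{|h(u)-h(v)| : u,v \in V(G)\}$, and the hamiltonian chromatic number $\mathrm{hc}(G)$ is the minimum span over all hamiltonian colorings of $G$. For a tree $T$ and $v \in V(T)$ let $w_T(v) = \sum_{u \in V(T)} d(u,v)$; a weight center of $T$ is a vertex minimizing $w_T$, and $W(T)$ denotes the set of weight centers (it consists of one vertex $w$, or of two adjacent vertices $w,w'$). Set $\zeta(T) = 0$ if $|W(T)| = 1$ and $\zeta(T) = 1$ if $|W(T)| = 2$, and $\zeta'(T) = 1 - \zeta(T)$. For $u \in V(T)$ let $\mathcal{L}(u) = \min\{D(u,x) : x \in W(T)\}$, and let $\mathcal{L}_W(T) = \sum_{u \in V(T)} \mathcal{L}(u)$. *)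

(* Defs.v *)
From mathcomp Require Import all_boot all_order all_algebra.
From mathcomp Require Import boolp.
Set Implicit Arguments.
Unset Strict Implicit.
Unset Printing Implicit Defensive.

Section Graph.
Variables (V : finType) (e : rel V).

Definition simple_graph : Prop := symmetric e /\ irreflexive e.

Definition connected_graph : Prop := forall u v : V, connect e u v.

(* [ucycle] requires distinct vertices; sequences of size 1 and 2 are not
   cycles of a simple graph. *)
Definition acyclic_graph : Prop :=
  forall c : seq V, 3 <= size c -> ~ ucycle e c.

Definition is_tree : Prop :=
  [/\ simple_graph, connected_graph & acyclic_graph].

Definition degree (v : V) : nat := #|[set u | e v u]|.

Definition max_degree : nat := \max_(v : V) degree v.

(* The path has vertex sequence u :: p, so its length is [size p]. *)
Definition upath (u v : V) (p : seq V) : bool :=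
  [&& path e u p, last u p == v & uniq (u :: p)].

Definition has_upath (u v : V) (k : nat) : bool :=
  [exists p : k.-tuple V, upath u v p].

(* In both definitions the range k < #|V| covers all path lengths, since the
   vertices of a path are distinct.  The value #|V| of [dist] is only reached
   when there is no path from u to v. *)
Definition detour (u v : V) : nat :=
  \max_(k < #|V| | has_upath u v k) k.

Definition dist (u v : V) : nat :=
  \big[minn/#|V|]_(k < #|V| | has_upath u v k) k.

Definition hamiltonian_coloring (h : V -> nat) : Prop :=
  forall u v : V, u != v -> #|V| - 1 <= detour u v + `|h u - h v|.

Definition span (h : V -> nat) : nat :=
  \max_(u : V) \max_(v : V) `|h u - h v|.

Lemma ex_hamiltonian_span :
  exists k : nat, `[< exists h, hamiltonian_coloring h /\ span h = k >].
Proof.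
pose h (u : V) := enum_rank u * #|V|.
exists (span h); apply/asboolP; exists h; split=> // u v neq_uv.
have : nat_of_ord (enum_rank u) != enum_rank v.
  by rewrite (inj_eq val_inj) (inj_eq enum_rank_inj).
rewrite /h => neq; apply: leq_trans (leq_addl _ _).
apply: leq_trans (leq_subr _ _) _.
wlog lt : u v {neq_uv neq} / enum_rank u < enum_rank v.
  by move=> wl; move: neq; rewrite neq_ltn => /orP[/wl //|/wl]; rewrite distnC.
rewrite distnEr ?leq_mul2r ?(ltnW lt) ?orbT // -mulnBl.
by rewrite leq_pmull // subn_gt0.
Qed.

Definition hc : nat := ex_minn ex_hamiltonian_span.

Definition weight (v : V) : nat := \sum_(u : V) dist u v.

Definition weight_centers : {set V} :=
  [set v | [forall u, weight v <= weight u]].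

Definition zeta : nat := if #|weight_centers| == 2 then 1 else 0.

Definition zeta' : nat := 1 - zeta.

(* #|V| exceeds every value of [detour], so it is a neutral default for the
   minimum over the nonempty set of weight centers. *)
Definition level (u : V) : nat :=
  \big[minn/#|V|]_(x in weight_centers) detour u x.

Definition total_level : nat := \sum_(u : V) level u.

End Graph.

(* Main.v *)
Require Import Defs.
From mathcomp Require Import all_boot all_order all_algebra.
From mathcomp Require Import boolp zify.
Import Order.TTheory GRing.Theory Num.Theory.
Set Implicit Arguments.
Unset Strict Implicit.
Unset Printing Implicit Defensive.

(** Paths in a tree are unique, so [detour] and [dist] coincide, and a vertex
    lying between [v] and [w] lies between [v] and [u] or between [u] and [w],
    for every [u].  If two weight centers [v], [w] were at distance at least 2,
    moving each of them one step towards the other would strictly decrease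
    [weight v + weight w]; hence weight centers form a clique, and a clique of a
    tree has at most two vertices.  It follows that
    [D(u, v) <= L(u) + L(v) + zeta].  List the vertices by increasing color and
    add up the coloring inequalities of consecutive vertices: every level is
    counted twice, except those of the first and the last vertex, which cannot
    both vanish if the weight center is unique. *)

Section Walks.
Variables (V : finType) (e : rel V).
Implicit Types (u v w : V) (p q : seq V) (k : nat).

Definition walk u v p : bool := path e u p && (last u p == v).

Lemma upathE u v p : upath e u v p = walk u v p && uniq (u :: p).
Proof. by rewrite /upath andbA. Qed.

Lemma upath_walk u v p : upath e u v p -> walk u v p.
Proof. by rewrite upathE => /andP[]. Qed.

Lemma upath_nil u p : upath e u u p -> p = [::].
Proof.
by case: p => // x p /and3P[_ /= /eqP uE]; rewrite -{1}uE mem_last.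
Qed.

Lemma upath_cons u v x p :
  upath e u v (x :: p) = [&& e u x, u \notin x :: p & upath e x v p].
Proof. by rewrite /upath /= -andbA; case: (u \notin _); rewrite ?andbF. Qed.

Lemma walk_cat u v w p q : walk u v p -> walk v w q -> walk u w (p ++ q).
Proof.
by move=> /andP[ep /eqP pv]; rewrite /walk cat_path last_cat ep pv.
Qed.

Lemma walk_split u w p q :
  walk u w (p ++ q) -> walk u (last u p) p /\ walk (last u p) w q.
Proof. by rewrite /walk cat_path last_cat eqxx => /andP[/andP[-> ->] ->]. Qed.

Lemma walk_rev u v p : symmetric e -> walk u v p ->
  exists2 q, walk v u q & v :: q = rev (u :: p).
Proof.
move=> e_sym /andP[ep /eqP <-]; exists (rev (belast u p)); last first.
  by rewrite (lastI u p) rev_rcons.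
apply/andP; split.
  by rewrite rev_path; apply: sub_path ep => x y; rewrite e_sym.
by case: p {ep} => //= x p; rewrite rev_cons last_rcons.
Qed.

Lemma walk_shorten u v p : walk u v p ->
  exists2 q, upath e u v q & {subset q <= p}.
Proof.
case/andP=> + /eqP <-; case/shortenP=> q path_q uniq_q sub_q.
by exists q; rewrite // /upath path_q eqxx.
Qed.

Lemma upath_size_lt u v p : upath e u v p -> size p < #|V|.
Proof.
by rewrite upathE => /andP[_ /card_uniqP up]; rewrite -[_.+1]up max_card.
Qed.

Lemma has_upathP u v k :
  reflect (exists2 p, upath e u v p & size p = k) (has_upath e u v k).
Proof.
apply: (iffP existsP) => [[p up]|[p up <-]]; last by exists (in_tuple p).
by exists p; rewrite ?size_tuple.
Qed.

Lemma detour_le_card u v : detour e u v <= #|V|.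
Proof. by apply/bigmax_leqP => k _; apply: ltnW. Qed.

Lemma upath_le_detour u v p : upath e u v p -> size p <= detour e u v.
Proof.
move=> up; apply: (bigop.bigmax_sup (Ordinal (upath_size_lt up))) => //.
by apply/has_upathP; exists p.
Qed.

Lemma dist_le_walk u v p : walk u v p -> dist e u v <= size p.
Proof.
case/walk_shorten=> q uq sub_q; have : size q <= size p.
  by apply: uniq_leq_size sub_q; case/and3P: uq => _ _ /andP[].
apply: leq_trans.
apply: (@bigmin_inf _ nat _ _ (Ordinal (upath_size_lt uq))) => //.
by apply/has_upathP; exists q.
Qed.

Lemma distxx u : dist e u u = 0.
Proof. by apply/eqP; rewrite -leqn0 (@dist_le_walk _ _ [::]) // /walk /=. Qed.

Lemma geodesic_upath u v p :
  walk u v p -> size p = dist e u v -> upath e u v p.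
Proof.
move=> wp pE; have [q uq sub_q] := walk_shorten wp.
rewrite upathE wp; apply: (@leq_size_uniq _ (u :: q)).
- by case/and3P: uq.
- by move=> x; rewrite !inE => /predU1P[->|/sub_q->]; rewrite ?eqxx ?orbT.
- by rewrite /= ltnS pE dist_le_walk ?upath_walk.
Qed.

End Walks.

Section ConnectedGraph.
Variables (V : finType) (e : rel V).
Hypothesis e_conn : connected_graph e.
Implicit Types (u v x : V) (k : nat).

Local Notation d := (dist e).

Definition between u x v : bool := d u x + d x v == d u v.

Lemma geodesic_exists u v : exists2 p, upath e u v p & size p = d u v.
Proof.
have /connectP[p0 ep0 vE] := e_conn u v.
have [p up _] : exists2 p, upath e u v p & {subset p <= p0}.
  by apply: walk_shorten; rewrite /walk ep0 vE eqxx.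
have [k /has_upathP[q uq qk] dE] :
    {k : 'I_#|V| | has_upath e u v k & d u v = k}.
  apply: (@eq_bigmin _ nat _ _ (Ordinal (upath_size_lt up))) => [|k _].
    by apply/has_upathP; exists p.
  exact: ltnW.
by exists q; rewrite // qk -dE.
Qed.

Lemma dist_triangle x u v : d u v <= d u x + d x v.
Proof.
have [p up <-] := geodesic_exists u x; have [q uq <-] := geodesic_exists x v.
by rewrite -size_cat dist_le_walk // (walk_cat (upath_walk up)) ?upath_walk.
Qed.

Lemma dist_le1 u v : (d u v <= 1) = (u == v) || e u v.
Proof.
apply/idP/orP => [|[/eqP->|euv]]; last 2 first.
- by rewrite distxx.
- by rewrite (@dist_le_walk _ _ _ _ [:: v]) // /walk /= euv eqxx.
have [p /upath_walk/andP[+ +] <-] := geodesic_exists u v.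
case: p => [|x [|y p]] //= => [_ uv _|/andP[eux _] /eqP <- _]; first by left.
by right.
Qed.

Lemma dist_eq0 u v : (d u v == 0) = (u == v).
Proof.
apply/eqP/eqP => [|->]; last exact: distxx.
have [p up <-] := geodesic_exists u v => /size0nil p0.
by move: up; rewrite p0 => /and3P[_ /eqP].
Qed.

Lemma between_at_dist u v k :
  k <= d u v -> exists2 x, between u x v & d u x = k.
Proof.
have [p up pE] := geodesic_exists u v => le_k.
have := upath_walk up; rewrite -{1}(cat_take_drop k p) => /walk_split[].
move=> /dist_le_walk + /dist_le_walk.
rewrite size_drop size_takel pE //; set x := last _ _ => le_ux le_xv.
by have := dist_triangle x u v; exists x; rewrite /between; lia.
Qed.

Lemma dist_sym u v : symmetric e -> d u v = d v u.
Proof.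
move=> e_sym; suff dist_le_rev x y : d x y <= d y x.
  by apply/eqP; rewrite eqn_leq !dist_le_rev.
have [p /upath_walk wp <-] := geodesic_exists y x.
have [q /dist_le_walk wq [qE]] := walk_rev e_sym wp.
by rewrite (leq_trans wq) // -ltnS -[_.+1]/(size (x :: q)) qE size_rev.
Qed.

End ConnectedGraph.

Section AcyclicGraph.
Variables (V : finType) (e : rel V).
Hypotheses (e_sym : symmetric e) (e_acyclic : acyclic_graph e).
Implicit Types (u v : V) (p q : seq V).

(* Otherwise [u] would close the walk from [a] to [b] into a cycle. *)
Lemma acyclic_neighbors_eq u a b p :
  e u a -> e u b -> walk e a b p -> u \notin a :: p -> a = b.
Proof.
move=> eua eub wp u_ap.
have [q /and3P[path_q /eqP qb uniq_aq] sub_q] := walk_shorten wp.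
apply/eqP/negPn/negP => neq_ab; apply: (e_acyclic (c := [:: u, a & q])).
  by case: q qb {path_q uniq_aq sub_q} => //= ab; rewrite ab eqxx in neq_ab.
apply/andP; split; first by rewrite /= rcons_path eua path_q qb e_sym.
rewrite cons_uniq uniq_aq andbT; apply: contra u_ap; rewrite !inE.
by case/predU1P=> [->|/sub_q->]; rewrite ?eqxx ?orbT.
Qed.

Lemma upath_unique u v p q : upath e u v p -> upath e u v q -> p = q.
Proof.
elim: p u q => [|a p IHp] u [|b q] //.
- by case/and3P=> _ /= /eqP <- _ /upath_nil.
- by move=> /[swap]; case/and3P=> _ /= /eqP <- _ /upath_nil.
rewrite !upath_cons => /and3P[eua u_ap up] /and3P[eub u_bq uq].
have [r wr rE] := walk_rev e_sym (upath_walk uq).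
have ab : a = b.
  apply: (acyclic_neighbors_eq eua eub (walk_cat (upath_walk up) wr)).
  rewrite -cat_cons mem_cat negb_or u_ap; apply: contra u_bq => u_r.
  by rewrite -mem_rev -rE inE u_r orbT.
by rewrite -ab in uq *; rewrite (IHp a q).
Qed.

Lemma acyclic_clique_card (A : {set V}) :
  {in A &, forall u v, u != v -> e u v} -> #|A| <= 2.
Proof.
move=> cliqueA; rewrite leqNgt; apply/negP.
case/card_gt2P=> [x [y [z [[xA yA zA] [xy yz zx]]]]].
apply: (e_acyclic (c := [:: x; y; z])) => //; apply/andP; split.
  by rewrite /= !cliqueA.
by rewrite /= !inE negb_or xy yz eq_sym zx.
Qed.

End AcyclicGraph.

Section WeightCenters.
Variables (V : finType) (e : rel V).

Lemma weight_centers_exist (v0 : V) : exists v, v \in weight_centers e.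
Proof.
case: (arg_minnP (i0 := v0) (P := predT) (weight e)) => // v _ min_v.
by exists v; rewrite inE; apply/forallP => u; apply: min_v.
Qed.

Lemma level_attained (u : V) :
  exists2 x, x \in weight_centers e & level e u = detour e u x.
Proof.
have [x0 x0W] := weight_centers_exist u.
have [x xW levelE] : {x | x \in weight_centers e & level e u = detour e u x}.
  by apply: (@eq_bigmin _ nat _ _ x0) => // x _; apply: detour_le_card.
by exists x.
Qed.

End WeightCenters.

Section Tree.
Variables (V : finType) (e : rel V).
Hypothesis e_tree : is_tree e.
Implicit Types (u v w x y : V) (p : seq V).

Local Notation d := (dist e).

Let e_sym : symmetric e. Proof. by case: e_tree => -[]. Qed.
Let e_conn : connected_graph e. Proof. by case: e_tree. Qed.
Let e_acyclic : acyclic_graph e. Proof. by case: e_tree. Qed.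
Let dC u v : d u v = d v u. Proof. exact: dist_sym. Qed.

Lemma tree_dist_upath u v p : upath e u v p -> d u v = size p.
Proof.
move=> up; have [q uq <-] := geodesic_exists e_conn u v.
by rewrite (upath_unique e_sym e_acyclic uq up).
Qed.

Lemma tree_detour_dist u v : detour e u v = d u v.
Proof.
have [p up pE] := geodesic_exists e_conn u v.
apply/eqP; rewrite eqn_leq -{2}pE upath_le_detour // andbT.
by apply/bigmax_leqP => k /has_upathP[q /tree_dist_upath-> ->].
Qed.

Lemma tree_mem_upath u v x p :
  upath e u v p -> (x \in u :: p) = between e u x v.
Proof.
move=> up; apply/idP/eqP => [x_up|dE].
  apply/eqP; rewrite eqn_leq dist_triangle // andbT.
  case/splitPl: x_up up => p1 p2 <- up.
  have [w1 w2] := walk_split (upath_walk up).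
  by rewrite (tree_dist_upath up) size_cat leq_add ?dist_le_walk.
have [q uq qE] := geodesic_exists e_conn u x.
have [r ur rE] := geodesic_exists e_conn x v.
have uqr : upath e u v (q ++ r).
  apply: geodesic_upath; last by rewrite size_cat qE rE.
  exact: walk_cat (upath_walk uq) (upath_walk ur).
rewrite (upath_unique e_sym e_acyclic up uqr) -cat_cons mem_cat.
by case/and3P: uq => _ /eqP <- _; rewrite mem_last.
Qed.

(* The path from [v] to [w] is contained in the walk from [v] to [w] via [u]. *)
Lemma tree_between_tripod u v w x :
  between e v x w -> between e v x u || between e u x w.
Proof.
have [p up _] := geodesic_exists e_conn v u.
have [q uq _] := geodesic_exists e_conn u w.
have [r ur sub_r] := walk_shorten (walk_cat (upath_walk up) (upath_walk uq)).
rewrite -(tree_mem_upath x up) -(tree_mem_upath x uq).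
rewrite -(tree_mem_upath x ur) !inE.
case/predU1P=> [->|/sub_r]; first by rewrite eqxx.
by rewrite mem_cat => /orP[]->; rewrite !orbT.
Qed.

(* [d u] is convex along the path from [v] to [w]. *)
Lemma tree_dist_inward u v w x y :
  between e v x w -> between e v y w -> d v x = d y w ->
  d u x + d u y <= d u v + d u w.
Proof.
move=> vxw vyw; move: (tree_between_tripod u vxw) (tree_between_tripod u vyw).
rewrite /between in vxw vyw *.
have := dist_triangle e_conn v u w; have := dist_triangle e_conn w u v.
by rewrite (dC v u) (dC w v) (dC x u) (dC y u); lia.
Qed.

Lemma tree_dist_inward_lt v w x y :
  between e v x w -> between e v y w -> d v x = d y w -> 0 < d v x < d v w ->
  d x y < d v w.
Proof.
move=> vxw vyw; move: (tree_between_tripod x vyw).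
rewrite /between in vxw vyw *.
by rewrite (dC y x); lia.
Qed.

Lemma tree_weight_inward_lt v w x y :
  between e v x w -> between e v y w -> d v x = d y w -> 0 < d v x < d v w ->
  weight e x + weight e y < weight e v + weight e w.
Proof.
move=> vxw vyw vx_yw vx_lt; rewrite /weight -!big_split /=.
rewrite (bigD1 x) //= [X in _ < X](bigD1 x) //= -addSn leq_add //.
  have := tree_dist_inward_lt vxw vyw vx_yw vx_lt.
  by move/eqP: vxw; rewrite distxx (dC x v); lia.
by apply: leq_sum => u _; apply: tree_dist_inward.
Qed.

Lemma tree_weight_centers_adjacent v w :
  v \in weight_centers e -> w \in weight_centers e -> v != w -> e v w.
Proof.
rewrite !inE => /forallP min_v /forallP min_w neq_vw.
have : d v w <= 1; last by rewrite dist_le1 // (negPf neq_vw).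
rewrite leqNgt; apply/negP => vw_gt1.
have [x vxw vx] := between_at_dist e_conn (ltnW vw_gt1).
have [y vyw vy] := between_at_dist e_conn (leq_subr 1 (d v w)).
have vx_yw : d v x = d y w by move/eqP: vyw; lia.
have vx_lt : 0 < d v x < d v w by rewrite vx.
have := tree_weight_inward_lt vxw vyw vx_yw vx_lt.
by rewrite ltnNge leq_add ?min_v ?min_w.
Qed.

Lemma tree_card_weight_centers : #|weight_centers e| <= 2.
Proof.
apply: (acyclic_clique_card e_acyclic) => v w.
exact: tree_weight_centers_adjacent.
Qed.

Lemma tree_zetaE : zeta e = (1 < #|weight_centers e|).
Proof.
by rewrite /zeta (eqn_leq _ 2) tree_card_weight_centers; case: leqP.
Qed.

Lemma tree_zeta_eq1 v w :
  v \in weight_centers e -> w \in weight_centers e -> v != w -> zeta e = 1.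
Proof.
move=> vW wW neq_vw; rewrite tree_zetaE.
by case: card_gt1P => // -[]; exists v, w.
Qed.

Lemma tree_dist_weight_centers v w :
  v \in weight_centers e -> w \in weight_centers e -> d v w <= zeta e.
Proof.
move=> vW wW; have [->|neq_vw] := eqVneq v w; first by rewrite distxx.
rewrite (tree_zeta_eq1 vW wW) // dist_le1 //.
by rewrite tree_weight_centers_adjacent ?orbT.
Qed.

Lemma tree_detour_le_level u v :
  detour e u v <= level e u + level e v + zeta e.
Proof.
have [x xW ->] := level_attained e u; have [y yW ->] := level_attained e v.
rewrite !tree_detour_dist; have := tree_dist_weight_centers xW yW.
have := dist_triangle e_conn x u v; have := dist_triangle e_conn y x v.
by rewrite (dC v y); lia.
Qed.

Lemma tree_level_eq0 u : level e u = 0 -> u \in weight_centers e.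
Proof.
have [x xW ->] := level_attained e u.
by move/eqP; rewrite tree_detour_dist dist_eq0 // => /eqP->.
Qed.

Lemma tree_zeta'_le_level u v : u != v -> zeta' e <= level e u + level e v.
Proof.
move=> neq_uv; case: (posnP (level e u + level e v)) => [/eqP|lvl_gt0].
  rewrite addn_eq0 => /andP[/eqP/tree_level_eq0 uW /eqP/tree_level_eq0 vW].
  by rewrite /zeta' (tree_zeta_eq1 uW vW).
by apply: leq_trans lvl_gt0; apply: leq_subr.
Qed.

End Tree.

Lemma distn_le_span (V : finType) (h : V -> nat) (u v : V) :
  `|h u - h v| <= Defs.span h.
Proof. by apply: leq_trans (leq_bigmax u); apply: leq_bigmax. Qed.

Section Separation.
Variables (V : finType) (h f : V -> nat) (K : nat).
Hypothesis h_sep : forall u v, u != v -> K <= f u + f v + `|h u - h v|.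
Implicit Types (u v x : V) (s : seq V).

Lemma separated_path_bound x s :
  path (relpre h leq) x s -> uniq (x :: s) ->
  K * size s + f x + f (last x s) + h x <=
    h (last x s) + 2 * \sum_(u <- x :: s) f u.
Proof.
elim: s x => [|y s IHs] x /=; first by rewrite big_seq1; lia.
case/andP=> /= le_xy y_s /andP[x_ys ys_uniq]; have := IHs y y_s ys_uniq.
have /h_sep : x != y by apply: contraNneq x_ys => ->; rewrite mem_head.
by rewrite (distnEr le_xy) (big_cons _ _ x) mulnS /=; lia.
Qed.

Variable m : nat.
Hypothesis f_pair_ge : forall u v, u != v -> m <= f u + f v.

Lemma separated_sorted_bound s :
  sorted (relpre h leq) s -> uniq s -> 1 < size s ->
  K * (size s - 1) + m <= Defs.span h + 2 * \sum_(u <- s) f u.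
Proof.
case: s => [|x [|y s]] // xys_sorted xys_uniq _.
have /f_pair_ge : x != last y s.
  have /andP[x_ys _] := xys_uniq.
  by apply: contraNneq x_ys => ->; apply: mem_last.
have := separated_path_bound xys_sorted xys_uniq.
by have := distn_le_span h (last y s) x; rewrite /= subn1 /=; lia.
Qed.

Lemma separated_span_bound : 1 < #|V| ->
  K * (#|V| - 1) + m <= Defs.span h + 2 * \sum_u f u.
Proof.
move=> V_gt1; pose s := sort (relpre h leq) (enum V).
have size_s : size s = #|V| by rewrite size_sort -cardE.
have -> : \sum_u f u = \sum_(u <- s) f u.
  by rewrite (perm_big _ (permEl (perm_sort _ _))) big_enum.
rewrite -size_s; apply: separated_sorted_bound; rewrite ?size_s //.
  by apply: sort_sorted => x y; apply: leq_total.
by rewrite sort_uniq enum_uniq.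
Qed.

End Separation.

Lemma hc_attained (V : finType) (e : rel V) :
  exists2 h, hamiltonian_coloring e h & Defs.span h = hc e.
Proof.
by rewrite /hc; case: ex_minnP => k /asboolP[h [h_col <-]] _; exists h.
Qed.

Lemma tree_hc_bound (V : finType) (e : rel V) : is_tree e -> 1 < #|V| ->
  (#|V| - 1) * (#|V| - 1 - zeta e) + zeta' e <= hc e + 2 * total_level e.
Proof.
move=> e_tree V_gt1; rewrite mulnC; have [h h_col <-] := hc_attained e.
apply: separated_span_bound (tree_zeta'_le_level e_tree) V_gt1 => u v neq_uv.
by have := tree_detour_le_level e_tree u v; have := h_col u v neq_uv; lia.
Qed.

Local Open Scope ring_scope.

Theorem theorem1 (V : finType) (e : rel V) (n : nat)
    (He : is_tree e) (Hn : #|V| = n) (Hn4 : (4 <= n)%N)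
    (HD : (3 <= max_degree e)%N) :
  (n%:Z - 1) * (n%:Z - 1 - (zeta e)%:Z) + (zeta' e)%:Z
    - 2 * (total_level e)%:Z <= (hc e)%:Z.
Proof.
have V_gt1 : (1 < #|V|)%N by rewrite Hn; apply: leq_trans Hn4.
have zeta_le : (zeta e <= n - 1)%N.
  by rewrite (tree_zetaE He); apply: leq_trans (leq_b1 _) _; lia.
rewrite lerBlDr !subzn //; last by apply: leq_trans Hn4.
by rewrite -!PoszM -!PoszD lez_nat -Hn tree_hc_bound.
Qed.
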